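(* Each of the 16 MP moves is derived as a sequence of the primary MP move, the pure sliding moves, and their inverses. That is: let $\Gamma$ and $\Gamma'$ be normal o-graphs such that $\Gamma'$ is obtained from $\Gamma$ by an MP move. Then there is a finite sequence of normal o-graphs $\Gamma=\Gamma_0,\Gamma_1,\dots,\Gamma_n=\Gamma'$ such that, for every $i$, $\Gamma_{i+1}$ is obtained from $\Gamma_i$ by a primary MP move, by a pure sliding move (of one of the types ps-I, ps-II, ps-III, ps-IV), or by the inverse of one of these moves.
   Context: **Normal o-graphs.** A normal o-graph is an oriented virtual link diagram (real crossings with sign $+$ or $-$) up to planar isotopy and the Reidemeister-type moves involving virtual crossings, which preserve exactly the real crossings and the way their ends are connected. Equivalently, it is the following data up to isomorphism: a finite nonempty set $V$ of vertices (real crossings), a sign in $\{+,-\}$ for each vertex, four ends (over-in, over-out, under-in, under-out) at each vertex, and a bijection from the set of all out-ends to the set of all in-ends (each matched pair is an edge), such that the resulting 4-valent graph is connected. **Dual branched triangulation.** Let $T(\Gamma)$ be the oriented complex obtained as follows. For each vertex of $\Gamma$ take a tetrahedron with ordered vertices $0<1<2<3$; let $F_i$ be the face opposite to $i$. At a positive vertex the tetrahedron is oriented so that the frame $(01,02,03)$ is negative, and over-in, over-out, under-in, under-out correspond to $F_0,F_1,F_2,F_3$. At a negative vertex the frame $(01,02,03)$ is positive, and over-in, over-out, under-in, under-out correspond to $F_1,F_0,F_3,F_2$. For each edge of $\Gamma$ glue the two corresponding faces by the order-preserving affine map (it is orientation-reversing). Then $\Gamma\mapsto T(\Gamma)$ is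 a bijection from normal o-graphs to connected finite complexes of oriented tetrahedra with ordered vertices and order-preserving, orientation-reversing pairings of all faces (up to isomorphism). The 2-skeleton $P(\Gamma)$ dual to $T(\Gamma)$ is a branched standard polyhedron: true vertices, edges, 2-cells of $P(\Gamma)$ are dual to tetrahedra, triangles, edges of $T(\Gamma)$. Moves are described on $T(\Gamma)$. **MP moves.** Consider two distinct tetrahedra glued along a triangle with vertices $c<d<e$, with remaining vertices $a$ and $b$ (all five regarded as distinct vertices of an abstract bipyramid). Choose a total order on $\{a,b,c,d,e\}$ extending the orders of both tetrahedra. Replace the two tetrahedra by the three tetrahedra $\{a,b,c,d\},\{a,b,d,e\},\{a,b,c,e\}$ around a new edge $ab$, ordered by restriction of the total order, with orientation of the bipyramid and gluings of its six outer faces unchanged. This is an MP move if it is not the case that $a,b$ are both smaller than $c$, and not the case that $a,b$ are both larger than $e$. Taking $a$ to be the apex for which the frame $(ac,ad,ae)$ is positive, the total orders give exactly 16 types of MP moves. **Primary MP move.** The MP move in which the five vertices are ordered $v_0<v_1<v_2<v_3<v_4$, the two tetrahedra $\{v_0,v_1,v_2,v_4\}$, $\{v_0,v_2,v_3,v_4\}$ are replaced by $\{v_1,v_2,v_3,v_4\}$, $\{v_0,v_1,v_3,v_4\}$, $\{v_0,v_1,v_2,v_3\}$, and all five tetrahedra correspond to positive vertices of the normal o-graph. **Pure sliding moves.** Let $E$ be an edge of $T(\Gamma)$, with ends $x<y$. Choose two triangles $f_1,f_2$ of $T(\Gamma)$ at two different places around $E$ (two different sides of the polygonal 2-cell dual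 to $E$); any triangle may first be replaced by a stack of two parallel copies, so $f_1,f_2$ may also be two parallel copies of one triangle. Let $p,q$ be the third vertices of $f_1,f_2$. Choose a total order on $\{x,y,p,q\}$ (abstractly distinct vertices) compatible with the orders of $f_1$ and $f_2$, such that $p,q$ are not both smaller than $x$ and not both larger than $y$. Cut $T(\Gamma)$ open along $f_1\cup f_2$ (joined along $E$) and insert a pillow consisting of two oppositely oriented tetrahedra, both with vertices $x,y,p,q$ in the chosen order, glued to each other along the faces $xpq$ and $ypq$; its four outer faces $xyp,xyp,xyq,xyq$ are glued to the four sides of the cut. So $E$ is replaced by two edges and a new edge $pq$ appears. Up to exchanging $p$ and $q$, the types are: ps-I: $p<x<q<y$; ps-II: $x<p<y<q$; ps-III: $p<x<y<q$; ps-IV: $x<p<q<y$. *)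

(* Defs.v *)
From mathcomp Require Import all_boot all_fingroup.

Set Implicit Arguments.
Unset Strict Implicit.
Unset Printing Implicit Defensive.

(* The out-ends and the in-ends of a vertex v are both indexed by (v, b), where
   b = true stands for over and b = false for under.  The bijection [link]
   sends an out-end to the in-end it is joined to. *)
Record ograph := OGraph {
  vert : finType;
  positive : vert -> bool;
  link : {perm (vert * bool)};
  vert_gt0 : 0 < #|vert|;
  vert_connected : forall v w : vert,
    connect [rel v1 v2 | [exists b, ((link (v1, b)).1 == v2)
                                 || ((link (v2, b)).1 == v1)]] v w
}.

(* A face is a pair (t, i): the face of the tetrahedron t opposite to the i-th
   vertex of t, the vertices 0 < 1 < 2 < 3 being numbered by 'I_4.
   [frame t] says whether the frame (01, 02, 03) of t is positive, and [glue]
   sends a face to the face glued to it, the gluing map being order-preserving. *)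
Record complex := Complex {
  tet : finType;
  frame : tet -> bool;
  glue : tet * 'I_4 -> tet * 'I_4
}.

(* The orientation induced on a face by its tetrahedron, compared with the one
   given by the order of the three vertices of the face. *)
Definition face_or (X : complex) (f : tet X * 'I_4) : bool :=
  frame f.1 (+) odd f.2.

Definition iso (X Y : complex) : Prop :=
  exists h : tet X -> tet Y,
    [/\ bijective h,
        forall t, frame (h t) = frame t
      & forall t i, glue (h t, i) = (h (glue (t, i)).1, (glue (t, i)).2)].

Section Dual.
Variable G : ograph.

Definition in_face (e : vert G * bool) : vert G * 'I_4 :=
  (e.1, if positive e.1 then (if e.2 then inord 0 else inord 2)
        else (if e.2 then inord 1 else inord 3)).

Definition out_face (e : vert G * bool) : vert G * 'I_4 :=
  (e.1, if positive e.1 then (if e.2 then inord 1 else inord 3)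
        else (if e.2 then inord 0 else inord 2)).

(* F_0 and F_1 carry the two over-ends and F_2 and F_3 the two under-ends; the
   out-ends are the odd faces at a positive vertex and the even faces at a
   negative one. *)
Definition face_end (f : vert G * 'I_4) : vert G * bool := (f.1, f.2 < 2).

Definition is_out (f : vert G * 'I_4) : bool := positive f.1 == odd f.2.

Definition dual_glue (f : vert G * 'I_4) : vert G * 'I_4 :=
  if is_out f then in_face (link G (face_end f))
  else out_face ((link G)^-1%g (face_end f)).

Definition dual : complex :=
  @Complex (vert G) (fun v => ~~ positive v) dual_glue.

Lemma face_end_in e : face_end (in_face e) = e.
Proof.
by case: e => v b; rewrite /face_end /=; case: positive; case: b; rewrite inordK.
Qed.

Lemma face_end_out e : face_end (out_face e) = e.
Proof.
by case: e => v b; rewrite /face_end /=; case: positive; case: b; rewrite inordK.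
Qed.

Lemma dual_glue_out e : dual_glue (out_face e) = in_face (link G e).
Proof.
rewrite /dual_glue face_end_out; suff -> : is_out (out_face e) by [].
by case: e => v b; rewrite /is_out /=; case: positive; case: b; rewrite inordK.
Qed.

Lemma dual_glue_in e : dual_glue (in_face (link G e)) = out_face e.
Proof.
rewrite /dual_glue face_end_in permK; suff -> : is_out (in_face (link G e)) = false by [].
by case: (link G e) => v b; rewrite /is_out /=; case: positive; case: b; rewrite inordK.
Qed.

End Dual.

(* The position of l among the vertices other than k: the inverse of lift k. *)
Definition pos n (k l : 'I_n.+2) : 'I_n.+1 := odflt ord0 (unlift k l).

(* The five vertices of the bipyramid are numbered increasingly by 'I_5, and
   a, b are the apices.  The tetrahedron omitting the vertex k has its i-th
   vertex numbered lift k i, and its face opposite to l is the face pos k l.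
   The old tetrahedra are tA (containing a, omitting b) and tB (containing b,
   omitting a); new k is the new tetrahedron omitting k, for k distinct from
   a and b.  The values of old_tet at tA, tB and of new at a, b are junk. *)
Section Bipyramid.
Variables (X Y : complex) (a b : 'I_5) (tA tB : tet X).
Variables (old_tet : tet X -> tet Y) (new : 'I_5 -> tet Y).

(* An outer face of the bipyramid omits one apex and one vertex l of the common
   triangle, so it also lies in the new tetrahedron omitting l. *)
Definition transfer (f : tet X * 'I_4) : tet Y * 'I_4 :=
  if f.1 == tA then (new (lift b f.2), pos (lift b f.2) b)
  else if f.1 == tB then (new (lift a f.2), pos (lift a f.2) a)
  else (old_tet f.1, f.2).

Definition common_face (f : tet X * 'I_4) : bool :=
  (f == (tA, pos b a)) || (f == (tB, pos a b)).

Definition two_three : Prop :=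
  [/\ tA != tB /\ glue (tA, pos b a) = (tB, pos a b),
      [/\ {in ~: [set tA; tB] &, injective old_tet},
          {in ~: [set a; b] &, injective new}
        & new @: (~: [set a; b]) = ~: (old_tet @: (~: [set tA; tB]))],
      forall k l, k \in ~: [set a; b] -> l \in ~: [set a; b] -> k != l ->
        glue (new k, pos k l) = (new l, pos l k),
      forall f, ~~ common_face f -> glue (transfer f) = transfer (glue f)
    & (* the orientation of the bipyramid, and of the other tetrahedra, is kept *)
      forall f, ~~ common_face f -> face_or (transfer f) = face_or f].

End Bipyramid.

Definition mp_move (G G' : ograph) : Prop :=
  exists (a b c d e : 'I_5) (tA tB : vert G)
         (old_vert : vert G -> vert G') (new : 'I_5 -> vert G'),
    [/\ uniq [:: a; b; c; d; e],
        c < d < e,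
        ~~ ((a < c) && (b < c)),
        ~~ ((e < a) && (e < b))
      & @two_three (dual G) (dual G') a b tA tB old_vert new].

Definition primary_mp (G G' : ograph) : Prop :=
  exists (tA tB : vert G)
         (old_vert : vert G -> vert G') (new : 'I_5 -> vert G'),
    [/\ @two_three (dual G) (dual G') (inord 1) (inord 3) tA tB old_vert new,
        positive tA, positive tB
      & [/\ positive (new (inord 0)), positive (new (inord 2))
          & positive (new (inord 4))]].

(* A flag (f, m) is a face f together with its edge opposite to the m-th of the
   three vertices of f.  [cross] passes through the triangle f to the face on
   its other side; [turn] passes through the tetrahedron of f to its other face
   containing the edge.  The flags (f, m) and cross (f, m) are the two sides of
   one place around the edge. *)
Definition cross (X : complex) (phi : (tet X * 'I_4) * 'I_3) :=
  (glue phi.1, phi.2).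

Definition turn (X : complex) (phi : (tet X * 'I_4) * 'I_3) :=
  let: ((t, k), m) := phi in ((t, lift k m), pos (lift k m) k).

(* Starting from phi1 and rotating around the edge one traverses a sector of
   tetrahedra that ends at phi2.  When phi2 = cross phi1 this is a full turn. *)
Definition sector (X : complex) (phi1 phi2 : (tet X * 'I_4) * 'I_3) : Prop :=
  exists n, iter n (fun phi => turn (cross phi)) (turn phi1) = phi2.

(* Cuts the glued pairs {f, g f} and {u, g u} and glues f to u, g f to g u. *)
Definition reglue (F : eqType) (g : F -> F) (f u : F) : F -> F := fun h =>
  if h == f then u else if h == u then f
  else if h == g f then g u else if h == g u then g f else g h.

(* The pillow consists of the tetrahedra inr true and inr false, whose vertices
   x, y, p, q are their positions in 'I_4.  It is first closed up, each face
   being glued to its copy in the other tetrahedron, and put next to X; it is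
   then opened along xyp and xyq, and X along f1 and f2, to reglue.
   F1 and F2 are the sides of f1 and f2 facing the sector between them that
   is covered by inr true; glue F1 and glue F2 are the opposite sides.  The
   side of f1 towards F1 receives the face xyp (opposite to q) of inr true, and
   that of f2 towards F2 receives its face xyq (opposite to p).
   If f1 and f2 are parallel copies of one triangle, the copy f2 of the stack is
   next to F2 when [near] holds and next to glue F2 otherwise; if they are
   different triangles, [near] makes no difference. *)
Section Pillow.
Variables (X : complex) (p q : 'I_4) (F1 F2 : tet X * 'I_4) (near : bool).

Definition into (f : tet X * 'I_4) : (tet X + bool) * 'I_4 := (inl f.1, f.2).

Definition closed_pillow (f : (tet X + bool) * 'I_4) : (tet X + bool) * 'I_4 :=
  match f with
  | (inl t, i) => into (glue (t, i))
  | (inr s, i) => (inr (~~ s), i)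
  end.

Definition pillow_glue : (tet X + bool) * 'I_4 -> (tet X + bool) * 'I_4 :=
  let g := reglue closed_pillow (into F1) (inr true, q) in
  if near then reglue g (into F2) (inr true, p)
  else reglue g (into (glue F2)) (inr false, p).

(* The orientation of inr true is the one for which the gluing of its face
   opposite to q with F1 is orientation-reversing. *)
Definition pillow_frame (t : tet X + bool) : bool :=
  match t with
  | inl t => frame t
  | inr s => (face_or F1 (+) odd q) (+) s
  end.

Definition pillow : complex := @Complex (tet X + bool)%type pillow_frame pillow_glue.

End Pillow.

(* The two triangles are compatible with the order of x, y, p, q: the third
   vertex of f1 has the position of p among x, y, p, and that of f2 has the
   position of q among x, y, q. *)
Definition pure_sliding (G G' : ograph) : Prop :=
  exists (x y p q : 'I_4) (F1 F2 : vert G * 'I_4) (near : bool),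
    [/\ uniq [:: x; y; p; q] /\ x < y,
        ~~ ((p < x) && (q < x)),
        ~~ ((y < p) && (y < q)),
        @sector (dual G) (F1, pos q p) (F2, pos p q)
      & iso (@pillow (dual G) p q F1 F2 near) (dual G')].

Definition elementary (G G' : ograph) : Prop :=
  primary_mp G G' \/ pure_sliding G G'.

(* Main.v *)
Require Import Defs.
From mathcomp Require Import all_boot all_fingroup zify.

(* Keep the total order of the five vertices of the bipyramid fixed.  The MP move
   with apices a, b can be performed by inserting a pillow of two tetrahedra abcd
   along acd and bcd: the inner one forms, with acde and bcde, the bipyramid with
   apices c, d, to which the inverse of the MP move with apices c, d applies.  The
   sliding is allowed exactly when {a, b} and {c, d} are not separated by the
   order, and the two MP moves induce opposite orientations on the boundary of
   the 4-simplex.  Hence it suffices to connect all types (a, b, orientation) to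
   that of the primary move, where (a, b) = (1, 3); this is possible because the
   graph of the 8 allowed pairs, joined when disjoint and not separated, is
   connected and contains the odd cycle 02, 13, 24, 03, 14. *)

Set Implicit Arguments.
Unset Strict Implicit.
Unset Printing Implicit Defensive.

(** * Positions of vertices in faces *)

Lemma pos_lift n (k : 'I_n.+2) (i : 'I_n.+1) : pos k (lift k i) = i.
Proof. by rewrite /pos liftK. Qed.

Lemma lift_pos n (k l : 'I_n.+2) : k != l -> lift k (pos k l) = l.
Proof. by case/unlift_some => j -> _; rewrite pos_lift. Qed.

Lemma val_pos n (k l : 'I_n.+2) : k != l -> pos k l = unbump k l :> nat.
Proof. by move=> kl; rewrite -[in RHS](lift_pos kl) /= bumpK. Qed.

Lemma pos_inj n (k l1 l2 : 'I_n.+2) :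
  k != l1 -> k != l2 -> (pos k l1 == pos k l2) = (l1 == l2).
Proof.
move=> k1 k2; apply/eqP/eqP => [e|-> //].
by rewrite -(lift_pos k1) -(lift_pos k2) e.
Qed.

Lemma ltn_pos n (k l1 l2 : 'I_n.+2) :
  k != l1 -> k != l2 -> (pos k l1 < pos k l2) = (l1 < l2).
Proof.
case/unlift_some => j1 -> _; case/unlift_some => j2 -> _.
by rewrite !pos_lift !ltnNge leq_bump2.
Qed.

Lemma lift_lift n (i j : 'I_n.+3) (x : 'I_n.+1) : i != j ->
  lift i (lift (pos i j) x) = lift j (lift (pos j i) x).
Proof.
move=> ij; have ji : j != i by rewrite eq_sym.
apply/val_inj; rewrite /= !val_pos // bumpC unbumpK ?inE 1?eq_sym //; congr bump.
congr bump; rewrite /unbump; congr (_ - nat_of_bool _).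
case: (ltngtP i j) => [ltij|ltji|/val_inj e]; last by rewrite e eqxx in ij.
  by rewrite subn1 ltnNge -ltnS (ltn_predK ltij) ltij.
by rewrite subn0.
Qed.

Lemma pos_pos n (i j k : 'I_n.+3) : i != j -> i != k -> j != k ->
  pos (pos i j) (pos i k) = pos (pos j i) (pos j k).
Proof.
move=> ij ik jk; have ji : j != i by rewrite eq_sym.
apply: (@lift_inj _ (pos j i)); apply: (@lift_inj _ j).
by rewrite -lift_lift // !lift_pos ?pos_inj.
Qed.

(** The larger of [k], [l] is shifted down by one and the smaller is not, so
    [pos k l + pos l k = k + l - 1]. The orientation checks for the bipyramid rest on this
    parity. *)
Lemma odd_pos n (k l : 'I_n.+2) : k != l ->
  odd (pos k l) = ~~ (odd k (+) odd l (+) odd (pos l k)).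
Proof.
move=> kl; rewrite !val_pos // 1?eq_sym // /unbump.
case: (ltngtP k l) => [ltkl|ltlk|/val_inj e]; last by rewrite e eqxx in kl.
  rewrite subn0 subn1 -(ltn_predK ltkl) /=.
  by case: (odd k) (odd l.-1) => [] [].
rewrite subn0 subn1 -(ltn_predK ltlk) /=.
by case: (odd l) (odd k.-1) => [] [].
Qed.

Lemma exists_notin n (s : seq 'I_n) : size s < n -> exists i, i \notin s.
Proof.
move=> ltsn; apply/existsP; rewrite -negb_forall; apply/negP => /forallP all_s.
have := @uniq_leq_size _ (enum 'I_n) s (enum_uniq _) (fun i _ => all_s i).
by rewrite size_enum_ord leqNgt ltsn.
Qed.

(** * Oriented complexes and o-graphs *)

(** With nonemptiness and connectedness, this characterizes the duals of o-graphs up to isomorphism,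
    by [dual_closed_oriented] and [realize]. *)
Definition closed_oriented (X : complex) : Prop :=
  involutive (@glue X) /\ forall f : tet X * 'I_4, face_or (glue f) = ~~ face_or f.

Lemma glue_neq (X : complex) (f : tet X * 'I_4) :
  closed_oriented X -> (glue f == f) = false.
Proof. by move=> coX; apply/eqP => e; have := coX.2 f; rewrite e; case: face_or. Qed.

Definition adjacent (X : complex) : rel (tet X) :=
  [rel s t | [exists i, (glue (s, i)).1 == t]].

Section Ends.
Variable X : complex.
Implicit Types (e : tet X * bool) (f : tet X * 'I_4).

(** The ends read off from a complex alone: a positive frame stands for a negative vertex, and the
    out-ends are the faces with [face_or] true. *)
Definition in_end_face e : tet X * 'I_4 :=
  (e.1, if frame e.1 then (if e.2 then inord 1 else inord 3)
        else (if e.2 then inord 0 else inord 2)).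

Definition out_end_face e : tet X * 'I_4 :=
  (e.1, if frame e.1 then (if e.2 then inord 0 else inord 2)
        else (if e.2 then inord 1 else inord 3)).

Definition end_of f : tet X * bool := (f.1, f.2 < 2).

Lemma out_end_faceK : cancel out_end_face end_of.
Proof.
by case=> v b; rewrite /end_of /=; case: frame; case: b; rewrite inordK.
Qed.

Lemma face_or_out_end e : face_or (out_end_face e).
Proof.
by case: e => v b; rewrite /face_or /=; case: frame; case: b; rewrite inordK.
Qed.

Lemma face_or_in_end e : face_or (in_end_face e) = false.
Proof.
by case: e => v b; rewrite /face_or /=; case: frame; case: b; rewrite inordK.
Qed.

Lemma end_ofK f :
  f = if face_or f then out_end_face (end_of f) else in_end_face (end_of f).
Proof.
case: f => v i; rewrite /face_or /out_end_face /in_end_face /=.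
by case: frame; case: i => [[|[|[|[|i]]]]] Hi //=; congr pair; apply/val_inj;
  rewrite /= inordK.
Qed.

End Ends.

Section DualClosed.
Variable G : ograph.
Implicit Types (e : vert G * bool) (f : vert G * 'I_4).

Lemma out_faceE e : out_face e = @out_end_face (dual G) e.
Proof. by rewrite /out_end_face /= if_neg. Qed.

Lemma in_faceE e : in_face e = @in_end_face (dual G) e.
Proof. by rewrite /in_end_face /= if_neg. Qed.

Lemma face_cases f : (exists e, f = out_face e) \/ (exists e, f = in_face (link G e)).
Proof.
rewrite (@end_ofK (dual G) f) -out_faceE -in_faceE; case: ifP => _.
  by left; eexists.
by right; exists ((link G)^-1%g (@end_of (dual G) f)); rewrite permKV.
Qed.

Lemma dual_closed_oriented : closed_oriented (dual G).
Proof.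
split=> f /=; case: (face_cases f) => -[e ->];
  by rewrite /= ?dual_glue_out ?dual_glue_in ?dual_glue_out // out_faceE in_faceE
    face_or_out_end face_or_in_end.
Qed.

Lemma dual_connected s t : connect (@adjacent (dual G)) s t.
Proof.
apply: (connect_sub _ (vert_connected s t)) => v w /= /existsP [b].
have adj e : adjacent (X := dual G) e.1 (link G e).1.
  by apply/existsP; exists (out_face e).2; rewrite /= dual_glue_out.
have adj' e : adjacent (X := dual G) (link G e).1 e.1.
  by apply/existsP; exists (in_face (link G e)).2; rewrite /= dual_glue_in.
case/orP => /eqP <-; [exact: connect1 (adj (_, _))|exact: connect1 (adj' (_, _))].
Qed.

End DualClosed.

Section Realize.
Variable X : complex.
Hypothesis coX : closed_oriented X.
Hypothesis ntX : 0 < #|tet X|.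
Hypothesis connX : forall s t, connect (@adjacent X) s t.

Definition link_fun (e : tet X * bool) := end_of (glue (out_end_face e)).

Lemma in_link_fun e : in_end_face (link_fun e) = glue (out_end_face e).
Proof. by rewrite [RHS]end_ofK coX.2 face_or_out_end. Qed.

Lemma link_fun_inj : injective link_fun.
Proof.
move=> e1 e2 e12; apply: (can_inj (@out_end_faceK X)); apply: (inv_inj coX.1).
by rewrite -!in_link_fun e12.
Qed.

Lemma link_connected (v w : tet X) :
  connect [rel v1 v2 | [exists b, ((perm link_fun_inj (v1, b)).1 == v2)
                               || ((perm link_fun_inj (v2, b)).1 == v1)]] v w.
Proof.
apply: (connect_sub _ (connX v w)) => s t /= /existsP [i /eqP st].
apply/connect1/existsP; case or_si : (face_or (s, i)).
  exists (i < 2); rewrite permE /link_fun.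
  by have := end_ofK (s, i); rewrite or_si /end_of /= => <-; rewrite st eqxx.
(* Here [(s, i)] carries an in-end, so the edge starts on the other side, at [t]. *)
have or_g : face_or (glue (s, i)) by rewrite coX.2 or_si.
exists ((glue (s, i)).2 < 2); rewrite !permE /link_fun.
move: (end_ofK (glue (s, i))); rewrite or_g /end_of st => <-.
by rewrite coX.1 eqxx orbT.
Qed.

Definition realization : ograph :=
  @OGraph (tet X) (fun t => ~~ frame t) (perm link_fun_inj) ntX link_connected.

Lemma out_realization e : out_face (G := realization) e = out_end_face e.
Proof. by rewrite /out_face /= if_neg. Qed.

Lemma in_realization e : in_face (G := realization) e = in_end_face e.
Proof. by rewrite /in_face /= if_neg. Qed.

Lemma realization_glue f : dual_glue (G := realization) f = glue f.
Proof.
case: (face_cases f) => -[e ->]; last first.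
  by rewrite dual_glue_in out_realization in_realization permE in_link_fun coX.1.
by rewrite dual_glue_out out_realization in_realization permE in_link_fun.
Qed.

(** Surjectivity of the passage to dual complexes; it turns a pillow, built as a complex, into an
    o-graph. *)
Lemma realize : exists G : ograph, iso X (dual G).
Proof.
exists realization, id; split=> [|t|t i].
- by exists id.
- by rewrite /= negbK.
- by rewrite /= realization_glue -surjective_pairing.
Qed.

End Realize.

(** * The pillow *)

Section Reglue.
Variables (F : eqType) (g : F -> F) (o : F -> bool) (f u : F).
Hypothesis gK : involutive g.
Hypothesis og : forall h, o (g h) = ~~ o h.
Hypothesis ofu : o f = ~~ o u.

(** As [f] and [u] have opposite orientations, the only possible coincidence among [f], [u], [g f],
    [g u] is that the two pairs are the same, [g f = u]; then regluing changes nothing. *)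
Lemma reglue_involutive : involutive (reglue g f u).
Proof.
have nfu : f != u by apply/eqP => e; move: ofu; rewrite e; case: (o u).
have fixg h : (g h == h) = false.
  by apply/eqP => e; move: (og h); rewrite e; case: (o h).
move=> h; rewrite /reglue.
case: (eqVneq h f) => [->|hf]; first by rewrite eqxx eq_sym (negbTE nfu).
case: (eqVneq h u) => [->|hu]; first by rewrite eqxx.
case: (eqVneq h (g f)) => [hgf|hgf].
  have guf : (g u == f) = false.
    by apply/eqP => e; move: hu; rewrite hgf -e gK eqxx.
  by rewrite guf (fixg u) (inj_eq (inv_inj gK)) eq_sym (negbTE nfu) eqxx hgf.
case: (eqVneq h (g u)) => [hgu|hgu].
  have gfu : (g f == u) = false.
    by apply/eqP => e; move: hf; rewrite hgu -e gK eqxx.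
  by rewrite (fixg f) gfu eqxx hgu.
by rewrite !(inv_eq gK) !gK (negbTE hf) (negbTE hu) (negbTE hgf) (negbTE hgu).
Qed.

Lemma reglue_reverses h : o (reglue g f u h) = ~~ o h.
Proof.
rewrite /reglue.
case: (eqVneq h f) => [->|hf]; first by rewrite ofu negbK.
case: (eqVneq h u) => [->|hu]; first exact: ofu.
case: (eqVneq h (g f)) => [->|hgf]; first by rewrite !og ofu negbK.
case: (eqVneq h (g u)) => [->|hgu]; first by rewrite !og ofu.
exact: og.
Qed.

End Reglue.

Section PillowClosed.
Variables (X : complex) (p q : 'I_4) (F1 F2 : tet X * 'I_4).
Hypothesis coX : closed_oriented X.
Hypothesis pq : p != q.
Hypothesis or12 : face_or F1 (+) face_or F2 = odd p (+) odd q.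

Let P := pillow p q F1 F2 true.

(** The frame of the pillow is chosen to fit [F1], and [or12] says that it fits [F2] as well. Hence
    both regluings join faces of opposite orientation. *)
Lemma pillow_closed_oriented : closed_oriented P.
Proof.
pose o := face_or (X := P).
pose g := @closed_pillow X.
have gK : involutive g.
  by case=> [[t|s] i] /=; rewrite ?negbK // /into -surjective_pairing coX.1.
have og h : o (g h) = ~~ o h.
  case: h => [[t|s] i]; last by rewrite /o /face_or /= addbN !addNb.
  exact: (coX.2 (t, i)).
have o1 : o (into F1) = ~~ o (inr true, q).
  by rewrite /o /face_or /=; case: (odd q); rewrite ?addbT ?addbF ?negbK.
have o2 : o (into F2) = ~~ o (inr true, p).
  rewrite [LHS](_ : _ = face_or F2) // /o {2}/face_or /= addbT addNb negbK.
  by rewrite -addbA [odd q (+) _]addbC -or12 addKb.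
split.
  exact: (reglue_involutive (reglue_involutive gK og o1)
           (reglue_reverses og o1) o2).
exact: (reglue_reverses (reglue_reverses og o1) o2).
Qed.

Hypothesis F12 : F1 != F2.

Lemma into_eq (f h : tet X * 'I_4) : (into f == into h) = (f == h).
Proof.
apply/eqP/eqP => [|-> //]; case: f h => t i [u j].
by rewrite /into => -[-> ->].
Qed.

Lemma into_inr f s (i : 'I_4) : (into f == ((inr s, i) : (tet X + bool) * 'I_4)) = false.
Proof. by rewrite xpair_eqE. Qed.

Lemma inr_into f s (i : 'I_4) : (((inr s, i) : (tet X + bool) * 'I_4) == into f) = false.
Proof. by rewrite eq_sym into_inr. Qed.

Lemma inr_eq s s' (i j : 'I_4) :
  (((inr s, i) : (tet X + bool) * 'I_4) == (inr s', j)) = (s == s') && (i == j).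
Proof. by rewrite xpair_eqE. Qed.

Let glueE := inv_eq coX.1.

Let pillow_simp := (into_inr, inr_into, into_eq, inr_eq).

Lemma closed_pillow_into (f : tet X * 'I_4) : closed_pillow (into f) = into (glue f).
Proof. by case: f. Qed.

Let g1 := reglue (@closed_pillow X) (into F1) (inr true, q).

Let g1_into f : g1 (into f) =
  if f == F1 then (inr true, q) else
  if f == glue F1 then (inr false, q) else into (glue f).
Proof. by rewrite /g1 /reglue !closed_pillow_into !pillow_simp. Qed.

Let g1_inrT i : g1 (inr true, i) = if i == q then into F1 else (inr false, i).
Proof.
by rewrite /g1 /reglue !closed_pillow_into /= !pillow_simp.
Qed.

Let g1_inrF i : g1 (inr false, i) = if i == q then into (glue F1) else (inr true, i).
Proof.
by rewrite /g1 /reglue !closed_pillow_into /= !pillow_simp.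
Qed.

Let glue_intoE (f : tet X * 'I_4) : glue (c := P) (into f) =
  if f == F2 then (inr true, p) else
  if into f == g1 (into F2) then (inr false, p) else g1 (into f).
Proof.
have -> : glue (c := P) (into f) = reglue g1 (into F2) (inr true, p) (into f) by [].
by rewrite /reglue !pillow_simp g1_inrT (negbTE pq) !pillow_simp.
Qed.

Lemma pillow_glue_F1 : glue (c := P) (into F1) = (inr true, q).
Proof.
rewrite glue_intoE (negbTE F12) !g1_into eqxx [F2 == F1]eq_sym (negbTE F12).
case: (eqVneq F2 (glue F1)) => [_|n]; rewrite !pillow_simp // [F1 == glue F2]eq_sym glueE.
by rewrite (negbTE n).
Qed.

Lemma pillow_glue_F2 : glue (c := P) (into F2) = (inr true, p).
Proof. by rewrite glue_intoE eqxx. Qed.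

Lemma pillow_glue_inr s i : i != p -> i != q ->
  glue (c := P) (inr s, i) = (inr (~~ s), i).
Proof.
move=> ip iq.
have -> : glue (c := P) (inr s, i) = reglue g1 (into F2) (inr true, p) (inr s, i) by [].
have g1i : g1 (inr s, i) = (inr (~~ s), i).
  by case: s; rewrite ?g1_inrT ?g1_inrF (negbTE iq).
rewrite /reglue g1_inrT !g1_into g1i !pillow_simp (negbTE ip) (negbTE pq) andbF.
rewrite [F2 == F1]eq_sym (negbTE F12).
by case: (F2 == glue F1); rewrite !pillow_simp ?(negbTE iq) (negbTE ip) !andbF.
Qed.

(* How a face of X is seen from outside the sector covered by inr true: the
   sides F1 and F2, hidden behind inr true, are replaced by the copies of f1 and
   f2 on inr false. *)
Definition outside (f : tet X * 'I_4) : tet P * 'I_4 :=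
  if f == F1 then (inr false, q) else
  if f == F2 then (inr false, p) else into f.

(** Towards the former partners of [F1] and [F2], the tetrahedron [inr false] takes the place of
    these two sides, so from outside the sector the complex still looks like [X]. *)
Lemma pillow_glue_outside f : glue (c := P) (outside f) = outside (glue f).
Proof.
have Pco := pillow_closed_oriented.1.
(* [H] treats the visible faces. A hidden face follows by applying [H] to its partner and using
   involutivity, unless [F1] and [F2] are partners of each other. *)
suff H h : h != F2 -> h != F1 -> glue (c := P) (into h) = outside (glue h).
  have H2 : glue F2 != F1 -> glue (c := P) (inr false, p) = into (glue F2).
    move=> n; rewrite -[RHS]Pco H ?(glue_neq _ coX) // /outside.
    by rewrite coX.1 [F2 == F1]eq_sym (negbTE F12) eqxx.
  have H1 : glue F2 != F1 -> glue (c := P) (inr false, q) = into (glue F1).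
    move=> n; rewrite -[RHS]Pco H ?(glue_neq _ coX) // /outside.
      by rewrite coX.1 eqxx.
    by rewrite glueE eq_sym.
  (* If f1 and f2 are one triangle, both its sides are hidden, and the two outer faces of
     [inr false] are glued to each other. *)
  have [e12|n12] := eqVneq (glue F2) F1.
    have e21 : glue F1 = F2 by rewrite -e12 coX.1.
    have Hq : glue (c := P) (inr false, q) = (inr false, p).
      have -> : glue (c := P) (inr false, q) =
                reglue g1 (into F2) (inr true, p) (inr false, q) by [].
      rewrite /reglue g1_inrT !g1_into e21 !pillow_simp eqxx [F2 == F1]eq_sym.
      by rewrite /= (negbTE F12) (negbTE pq) eqxx.
    have Hp : glue (c := P) (inr false, p) = (inr false, q) by rewrite -[RHS]Pco Hq.
    rewrite {1}/outside; case: eqVneq => [->|n1].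
      by rewrite Hq e21 /outside eq_sym (negbTE F12) eqxx.
    case: eqVneq => [->|n2]; last exact: H.
    by rewrite Hp e12 /outside eqxx.
  rewrite {1}/outside; case: eqVneq => [->|n1].
    rewrite H1 // /outside (glue_neq _ coX); case: eqVneq => // e.
    by rewrite -e coX.1 eqxx in n12.
  case: eqVneq => [->|n2]; last exact: H.
  by rewrite H2 // /outside (glue_neq _ coX) (negbTE n12).
move=> n2 n1; rewrite glue_intoE (negbTE n2) !g1_into (negbTE n1) [F2 == F1]eq_sym.
rewrite (negbTE F12) /outside !glueE.
have [e|n] := eqVneq F2 (glue F1).
  rewrite !pillow_simp; case: (eqVneq h (glue F1)) => [e'|_].
    by rewrite e' -e eqxx in n2.
  by rewrite e coX.1 (negbTE n1).
rewrite !pillow_simp.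
case: (eqVneq h (glue F2)) => [->|_].
  by rewrite (inj_eq (inv_inj coX.1)) eq_sym (negbTE F12).
by case: eqVneq.
Qed.

Lemma face_or_outside f : face_or (outside f) = face_or f.
Proof.
rewrite /outside; case: eqVneq => [->|_].
  by rewrite {1}/face_or /= addbF addbK.
case: eqVneq => [->|_]; last by [].
by rewrite {1}/face_or /= addbF -addbA [odd q (+) _]addbC -or12 addKb.
Qed.

(** A step of a path in [X] through a hidden face is rerouted through [inr true] and [inr false],
    which share their faces other than [p] and [q]. *)
Lemma pillow_connected :
  (forall s t, connect (@adjacent X) s t) ->
  forall s t, connect (@adjacent P) s t.
Proof.
move=> connX.
have adjP f : connect (@adjacent P) f.1 (glue (c := P) f).1.
  by apply/connect1/existsP; exists f.2; rewrite -surjective_pairing.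
have symP : connect_sym (@adjacent P).
  suff sub s t : adjacent (X := P) s t -> adjacent (X := P) t s.
    by apply: sym_connect_sym => s t; apply/idP/idP; exact: sub.
  case/existsP => i /eqP <-; apply/existsP; exists (glue (c := P) (s, i)).2.
  by rewrite -surjective_pairing pillow_closed_oriented.1.
have TF : connect (@adjacent P) (inr true) (inr false).
  have [i] : exists i : 'I_4, i \notin [:: p; q].
    exact: exists_notin.
  rewrite !inE negb_or => /andP [ip iq].
  by have := adjP (inr true, i); rewrite pillow_glue_inr.
have out f : connect (@adjacent P) (inl f.1) (outside f).1.
  rewrite /outside; case: eqVneq => [->|_].
    by apply: connect_trans TF; have := adjP (into F1); rewrite pillow_glue_F1.
  case: eqVneq => [->|_]; last exact: connect0.
  by apply: connect_trans TF; have := adjP (into F2); rewrite pillow_glue_F2.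
have inlP s t : connect (@adjacent P) (inl s) (inl t).
  have /connectP [r] := connX s t.
  elim: r s => [|u r IHr] s /= => [_ ->|/andP [/existsP [i /eqP <-] path_r] last_r].
    exact: connect0.
  apply: connect_trans (IHr _ path_r last_r); apply: connect_trans (out (s, i)) _.
  apply: connect_trans (adjP _) _; rewrite pillow_glue_outside.
  by rewrite symP; exact: out.
have inlF s : connect (@adjacent P) (inl F1.1) s.
  case: s => [s|s]; first exact: inlP.
  have FT : connect (@adjacent P) (inl F1.1) (inr true).
    by have := adjP (into F1); rewrite pillow_glue_F1.
  by case: s => //; exact: connect_trans TF.
by move=> s t; apply: connect_trans (inlF t); rewrite symP.
Qed.

End PillowClosed.

(** * Replacing an MP move by a sliding and an inverse MP move *)

Lemma two_three_iso X Y Z a b tA tB old_tet new :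
  iso Y Z -> @two_three X Y a b tA tB old_tet new ->
  exists old_tet' new', @two_three X Z a b tA tB old_tet' new'.
Proof.
case=> h [bij_h frame_h glue_h] [AB [old_inj new_inj cover] newE glueE orE].
have h_inj := bij_inj bij_h.
pose hf (f : tet Y * 'I_4) : tet Z * 'I_4 := (h f.1, f.2).
have hf_transfer f : transfer a b tA tB (h \o old_tet) (h \o new) f =
                     hf (transfer a b tA tB old_tet new f).
  by rewrite /transfer; case: ifP => _ //; case: ifP.
have hf_glue f : glue (hf f) = hf (glue f) by case: f => t i; rewrite /hf glue_h.
exists (h \o old_tet), (h \o new); split=> //.
- split.
  + by move=> s t sP tP /h_inj; exact: old_inj.
  + by move=> k l kP lP /h_inj; exact: new_inj.
  rewrite (imset_comp h new) (imset_comp h old_tet) cover; apply/setP => z; have [h' h'K hK'] := bij_h.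
  by rewrite -(hK' z) inE !mem_imset // inE.
- by move=> k l kP lP kl; rewrite /= glue_h newE.
- by move=> f fP; rewrite !hf_transfer hf_glue glueE.
- by move=> f fP; rewrite hf_transfer -orE // /face_or /= frame_h.
Qed.

Section PillowStep.
Variables (X Y : complex) (a b c d e : 'I_5) (tA tB : tet X).
Variables (old_tet : tet X -> tet Y) (new : 'I_5 -> tet Y).
Hypothesis coX : closed_oriented X.
Hypothesis abcde : uniq [:: a; b; c; d; e].
Hypothesis H : two_three a b tA tB old_tet new.

Let neqs : [/\ [/\ a != b, a != c, a != d & a != e],
               [/\ b != a, b != c, b != d & b != e],
               [/\ c != a, c != b, c != d & c != e],
               [/\ d != a, d != b, d != c & d != e]
             & [/\ e != a, e != b, e != c & e != d]].
Proof.
move: abcde; rewrite /= !inE !negb_or !andbT.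
move=> /and4P [/and4P [ab ac ad ae] /and3P [bc bd be] /andP [cd ce] de].
by do !split=> //; rewrite eq_sym.
Qed.

Let cover5 k : k \in [:: a; b; c; d; e].
Proof.
have sub : {subset [:: a; b; c; d; e] <= enum 'I_5} by move=> l _; rewrite mem_enum.
have [|_ ->] := uniq_min_size abcde sub; first by rewrite size_enum_ord.
by rewrite mem_enum.
Qed.

(** Both tetrahedra of the pillow are abcd, which omits [e]. [F1] is the face acd of acde and [F2]
    the face bcd of bcde. *)
Let p := pos e a.
Let q := pos e b.
Let F1 := (tA, pos b e).
Let F2 := (tB, pos a e).
Let P := pillow p q F1 F2 true.

(** The MP move with apices c, d keeps the image of [old_tet], where this inverts [old_tet], and
    [new e], for which the default [inr false] is intended. At [new c] and [new d] the default is
    junk. *)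
Definition pillow_old_tet (t' : tet Y) : tet P :=
  if [pick t | (t \notin [set tA; tB]) && (old_tet t == t')] is Some t
  then inl t else inr false.

Definition pillow_new (k : 'I_5) : tet P :=
  if k == a then inl tB else if k == b then inl tA else inr true.

Let AB : tA != tB. Proof. by case: H => -[]. Qed.
Let BA : (tB == tA) = false. Proof. by rewrite eq_sym (negbTE AB). Qed.

Let in_cde k : (k \in ~: [set a; b]) = (k \in [:: c; d; e]).
Proof.
case: neqs => -[ab ac ad ae] [ba bc bd be] [ca cb cd ce] [da db dc de] [ea eb ec ed].
have := cover5 k; rewrite !inE; do !(case/orP || move/eqP->);
  by rewrite ?eqxx ?(negbTE ac, negbTE ad, negbTE ae, negbTE bc, negbTE bd, negbTE be,
             negbTE ca, negbTE da, negbTE ea, negbTE cb, negbTE db, negbTE eb) ?orbT.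
Qed.

(** For a tetrahedron t omitting the vertex k, [frame t (+) odd k] is its orientation relative to
    the boundary of the 4-simplex. As the gluing reverses face orientations, [tA] and [tB] have the
    same value. *)
Lemma frame_other_apex : frame tB = frame tA (+) odd b (+) odd a.
Proof.
case: neqs => -[ab ac ad ae] [ba bc bd be] _ _ _.
case: H => -[_ gAB] _ _ _ _.
have := coX.2 (tA, pos b a); rewrite gAB /face_or /= (odd_pos ab).
by case: (frame tA) (frame tB) (odd a) (odd b) (odd (pos b a)) => [] [] [] [] [].
Qed.

(** An outer face passes from [tA] to [new k] with its orientation, so the new tetrahedra have the
    opposite orientation relative to the boundary of the 4-simplex. *)
Lemma frame_new k : k \in ~: [set a; b] ->
  frame (new k) = ~~ (frame tA (+) odd b (+) odd k).
Proof.
rewrite !inE negb_or => /andP [ka kb]; have bk : b != k by rewrite eq_sym.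
have ba : b != a by case: neqs => _ [].
case: H => _ _ _ _ /(_ (tA, pos b k)).
rewrite /common_face !xpair_eqE eqxx (negbTE AB) orbF /= pos_inj // => /(_ ka).
rewrite /transfer eqxx /face_or /= lift_pos // (odd_pos kb).
by case: (frame tA) (frame (new k)) (odd k) (odd b) (odd (pos b k)) => [] [] [] [] [].
Qed.

Lemma pillow_step_orientation : face_or F1 (+) face_or F2 = odd p (+) odd q.
Proof.
case: neqs => -[_ _ _ ae] [_ _ _ be] _ _ _.
rewrite /face_or /= frame_other_apex /p /q (odd_pos be) (odd_pos ae).
by case: (frame tA) (odd a) (odd b) (odd e) (odd (pos e a)) (odd (pos e b))
  => [] [] [] [] [] [].
Qed.

Lemma tet_cases (s : tet Y) :
  (exists2 k, k \in ~: [set a; b] & s = new k) \/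
  (exists2 t, t \notin [set tA; tB] & s = old_tet t).
Proof.
have [_ [_ _ cov] _ _ _] := H.
have [] := boolP (s \in new @: (~: [set a; b])) => [/imsetP [k kP ->]|].
  by left; exists k.
rewrite cov inE negbK => /imsetP [t]; rewrite inE => tP ->.
by right; exists t.
Qed.

Lemma new_neq_old k t : k \in ~: [set a; b] -> t \notin [set tA; tB] ->
  (new k == old_tet t) = false.
Proof.
move=> kP tP; have [_ [_ _ cov] _ _ _] := H; apply/eqP => e_kt.
have : new k \in new @: (~: [set a; b]) by exact: imset_f.
by rewrite cov inE e_kt imset_f // inE.
Qed.

Lemma new_eq k l : k \in ~: [set a; b] -> l \in ~: [set a; b] ->
  (new k == new l) = (k == l).
Proof.
have [_ [_ new_inj _] _ _ _] := H; move=> kP lP.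
by apply/eqP/eqP => [/new_inj ->|->].
Qed.

Lemma pillow_old_tet_old t : t \notin [set tA; tB] -> pillow_old_tet (old_tet t) = inl t.
Proof.
have [_ [old_inj _ _] _ _ _] := H; move=> tP; rewrite /pillow_old_tet.
case: pickP => [u /andP [uP /eqP e_ut]|/(_ t)]; last by rewrite tP eqxx.
by rewrite (old_inj u t) // in_setC.
Qed.

Lemma pillow_old_tet_new k : k \in ~: [set a; b] -> pillow_old_tet (new k) = inr false.
Proof.
move=> kP; rewrite /pillow_old_tet; case: pickP => // u /andP [uP].
by rewrite eq_sym new_neq_old.
Qed.

Let transfer' := @transfer Y P c d (new d) (new c) pillow_old_tet pillow_new.

Let cP : c \in ~: [set a; b]. Proof. by rewrite in_cde mem_head. Qed.
Let dP : d \in ~: [set a; b]. Proof. by rewrite in_cde !inE eqxx orbT. Qed.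
Let eP : e \in ~: [set a; b]. Proof. by rewrite in_cde !inE eqxx !orbT. Qed.

Let transfer'_c l : c != l -> transfer' (new c, pos c l) = (pillow_new l, pos l c).
Proof.
case: neqs => _ _ [_ _ cd _] _ _ cl.
by rewrite /transfer' /transfer /= new_eq // (negbTE cd) eqxx lift_pos.
Qed.

Let transfer'_d l : d != l -> transfer' (new d, pos d l) = (pillow_new l, pos l d).
Proof. by move=> dl; rewrite /transfer' /transfer /= eqxx lift_pos. Qed.

Let transfer'_e i : transfer' (new e, i) = (inr false, i).
Proof.
case: neqs => _ _ _ _ [_ _ ec ed].
by rewrite /transfer' /transfer /= !new_eq // (negbTE ec) (negbTE ed) pillow_old_tet_new.
Qed.

Let pillow_new_a : pillow_new a = inl tB. Proof. by rewrite /pillow_new eqxx. Qed.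

Let pillow_new_b : pillow_new b = inl tA.
Proof. by case: neqs => _ [ba _ _ _] _ _ _; rewrite /pillow_new eqxx (negbTE ba). Qed.

Let pillow_new_e : pillow_new e = inr true.
Proof.
by case: neqs => _ _ _ _ [ea eb _ _]; rewrite /pillow_new (negbTE ea) (negbTE eb).
Qed.

(* Replacing acde, bcde by the tetrahedra around ab, and then those by acde, bcde
   and abcd around cd, amounts to inserting the pillow. *)
Let transfer_outside f : ~~ common_face a b tA tB f ->
  transfer' (transfer a b tA tB old_tet new f) = outside p q F1 F2 f.
Proof.
case: neqs => -[ab ac ad ae] [ba bc bd be] [ca cb cd ce] [da db dc de] [ea eb ec ed].
case: f => t i; rewrite /common_face /transfer /= !xpair_eqE.
case: (eqVneq t tA) => [->|tA'].
  rewrite (negbTE AB) orbF -[i](pos_lift b) lift_pos ?neq_lift //.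
  have bl := neq_lift b i; rewrite pos_inj // /outside !xpair_eqE eqxx (negbTE AB) /=.
  move: (lift b i) bl (cover5 (lift b i)) => l bl; rewrite pos_inj // !inE.
  have/negbTE lb : l != b by rewrite eq_sym.
  rewrite lb /= => /or4P [] /eqP ->; rewrite ?eqxx // => _.
  - by rewrite transfer'_c // pillow_new_b (negbTE ce).
  - by rewrite transfer'_d // pillow_new_b (negbTE de).
case: (eqVneq t tB) => [->|tB'].
  rewrite /= -[i](pos_lift a) lift_pos ?neq_lift //.
  have al := neq_lift a i; rewrite pos_inj // /outside !xpair_eqE eqxx BA /=.
  move: (lift a i) al (cover5 (lift a i)) => l al; rewrite pos_inj // !inE.
  have/negbTE la : l != a by rewrite eq_sym.
  rewrite la /= => /or4P [] /eqP ->; rewrite ?eqxx // => _.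
  - by rewrite transfer'_c // pillow_new_a (negbTE ce).
  - by rewrite transfer'_d // pillow_new_a (negbTE de).
have tP : t \notin [set tA; tB] by rewrite !inE negb_or tA' tB'.
move=> _; rewrite /transfer' /transfer /= ![old_tet t == _]eq_sym.
rewrite !new_neq_old // pillow_old_tet_old //.
by rewrite /outside !xpair_eqE (negbTE tA') (negbTE tB').
Qed.

Lemma common_face_glue f :
  common_face a b tA tB (glue f) = common_face a b tA tB f.
Proof.
have [[_ gAB] _ _ _ _] := H.
by rewrite /common_face !(inv_eq coX.1) -gAB coX.1 orbC.
Qed.

Let F12 : F1 != F2.
Proof. by rewrite xpair_eqE (negbTE AB). Qed.

Let pq : p != q.
Proof.
by case: neqs => -[ab _ _ _] _ _ _ [ea eb _ _]; rewrite /p /q pos_inj.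
Qed.

Let PK := (pillow_closed_oriented coX pillow_step_orientation).1.

Let common' := @common_face Y c d (new d) (new c).

(** The faces that do not come from [X] are the sides of abd, between [new e] and [new c], and of
    abc, between [new e] and [new d]. They become the two triangles shared by the halves of the
    pillow. *)
Lemma pillow_step_face_cases (f : tet Y * 'I_4) : ~~ common' f ->
  (exists2 g, ~~ common_face a b tA tB g & f = transfer a b tA tB old_tet new g) \/
  exists2 k, k \in [:: c; d] &
    f = (new k, pos k e) \/ f = (new e, pos e k).
Proof.
case: neqs => -[ab ac ad ae] [ba bc bd be] [ca cb cd ce] [da db dc de] [ea eb ec ed].
case: f => s i; have [[k kP ->]|[t tP ->]] := tet_cases s; last first.
  move: tP; rewrite !inE negb_or => /andP [tA' tB'] _; left; exists (t, i).
    by rewrite /common_face !xpair_eqE (negbTE tA') (negbTE tB').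
  by rewrite /transfer /= (negbTE tA') (negbTE tB').
rewrite -[i](pos_lift k); have := neq_lift k i; move: (lift k i) => {i} l kl.
have [ak bk] : a != k /\ b != k.
  by move: kP; rewrite !inE negb_or => /andP [? ?]; rewrite ![_ == k]eq_sym.
rewrite /common' /common_face !xpair_eqE !new_eq //.
have := cover5 l; rewrite !inE => /or4P [/eqP lE|/eqP lE|/eqP lE|lE]; rewrite ?lE.
- move=> _; left; exists (tB, pos a k).
    by rewrite /common_face !xpair_eqE BA eqxx pos_inj //= eq_sym.
  by rewrite /transfer /= BA eqxx lift_pos.
- move=> _; left; exists (tA, pos b k).
    by rewrite /common_face !xpair_eqE (negbTE AB) eqxx pos_inj //= orbF eq_sym.
  by rewrite /transfer /= eqxx lift_pos.
- move: kP kl; rewrite in_cde lE !inE => /or3P [] /eqP ->; rewrite ?eqxx //= => _ _.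
  by right; exists c; rewrite ?inE ?eqxx //; right.
- move: kP kl lE; rewrite in_cde !inE => /or3P [] /eqP -> kl /orP [] /eqP lE;
    move: kl; rewrite lE ?eqxx ?orbT //= => _ _; right.
  + by exists c; rewrite ?inE ?eqxx //; left.
  + by exists d; rewrite ?inE ?eqxx ?orbT //; left.
  + by exists d; rewrite ?inE ?eqxx ?orbT //; right.
Qed.

Let glue_inr_e s k : k \in [:: c; d] ->
  glue (c := P) (inr s, pos e k) = (inr (~~ s), pos e k).
Proof.
case: neqs => _ _ [ca cb _ ce] [da db _ de] [ea eb ec ed] kcd.
have ek : e != k by move: kcd; rewrite !inE => /orP [] /eqP ->.
apply: (pillow_glue_inr pq F12); rewrite pos_inj //;
  by move: kcd; rewrite !inE => /orP [] /eqP ->.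
Qed.

Let cdP k : k \in [:: c; d] -> k \in ~: [set a; b] /\ e != k.
Proof.
case: neqs => _ _ _ _ [_ _ ec ed].
by rewrite !inE => /orP [] /eqP ->; rewrite ?ec ?ed; move: cP dP; rewrite !inE.
Qed.

Let transfer'_cd k : k \in [:: c; d] ->
  transfer' (new k, pos k e) = (inr true, pos e k).
Proof.
case: neqs => _ _ [_ _ _ ce] [_ _ _ de] _.
rewrite !inE => /orP [] /eqP ->; by rewrite ?transfer'_c ?transfer'_d // pillow_new_e.
Qed.

(** [new d] omits d and contains the apex c, so it takes the place of [tA], and [new c] that of
    [tB]. The tetrahedra created around cd are the original acde, bcde and the inner [inr true],
    while [new e] survives as [inr false]. *)
Lemma two_three_pillow :
  @two_three Y P c d (new d) (new c) pillow_old_tet pillow_new.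
Proof.
case: neqs => -[ab ac ad ae] [ba bc bd be] [ca cb cd ce] [da db dc de] [ea eb ec ed].
have [[_ gAB] _ newE glueE orE] := H.
have abe k : k \in ~: [set c; d] -> [\/ k = a, k = b | k = e].
  have := cover5 k; rewrite !inE.
  by case: (k == c) (k == d) => [] [] //=; case/or3P => /eqP; constructor.
split.
- by rewrite new_eq // newE.
- have tet_casesN s : s \in ~: [set new d; new c] ->
      s = new e \/ exists2 t, t \notin [set tA; tB] & s = old_tet t.
    have [[k kP ->]|[t tP ->]] := tet_cases s; last by right; exists t.
    rewrite !inE !new_eq //; move: kP; rewrite in_cde !inE.
    by case/or3P => /eqP ->; rewrite ?eqxx ?orbT //; left.
  split.
  + move=> s t /tet_casesN [->|[s' sP ->]] /tet_casesN [->|[t' tP ->]];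
      rewrite ?pillow_old_tet_new ?pillow_old_tet_old //.
    by case=> ->.
  + move=> k l /abe [] -> /abe [] ->;
      rewrite ?pillow_new_a ?pillow_new_b ?pillow_new_e // => -[] tAB;
      by move: AB; rewrite tAB eqxx.
  have newP z : (z \in pillow_new @: (~: [set c; d])) =
      match z with inl t => t \in [set tA; tB] | inr s => s end.
    apply/imsetP/idP => [[k /abe [] -> ->]|].
    - by rewrite pillow_new_a !inE eqxx orbT.
    - by rewrite pillow_new_b !inE eqxx.
    - by rewrite pillow_new_e.
    case: z => [t|[] //]; rewrite ?inE.
      case/orP => /eqP ->.
        by exists b; rewrite ?pillow_new_b // !inE negb_or bc bd.
      by exists a; rewrite ?pillow_new_a // !inE negb_or ac ad.
    by exists e; rewrite ?pillow_new_e // !inE negb_or ec ed.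
  have oldP z : (z \in pillow_old_tet @: (~: [set new d; new c])) =
      match z with inl t => t \notin [set tA; tB] | inr s => ~~ s end.
    apply/imsetP/idP => [[s /tet_casesN [->|[t tP ->]] ->]|].
    - by rewrite pillow_old_tet_new.
    - by rewrite pillow_old_tet_old.
    case: z => [t tP|[] // _].
      exists (old_tet t); rewrite ?pillow_old_tet_old // !inE ![old_tet t == _]eq_sym.
      by rewrite !new_neq_old.
    by exists (new e); rewrite ?pillow_old_tet_new // !inE !new_eq // negb_or ed ec.
  by apply/setP => z; rewrite [RHS]inE newP oldP; case: z => z; rewrite negbK.
- have outA : outside p q F1 F2 (tA, pos b a) = (inl tA, pos b a).
    by rewrite /outside !xpair_eqE eqxx pos_inj // (negbTE ae) (negbTE AB).
  have outB : outside p q F1 F2 (tB, pos a b) = (inl tB, pos a b).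
    by rewrite /outside !xpair_eqE eqxx pos_inj // (negbTE be) BA.
  have glueAB : glue (c := P) (inl tA, pos b a) = (inl tB, pos a b).
    rewrite -outA (pillow_glue_outside coX pq pillow_step_orientation F12).
    by rewrite gAB outB.
  (* The tetrahedra omitting a and b meet along cde, which the pillow does not cut; [inr true] meets
     [tA] along acd at [F1] and [tB] along bcd at [F2]. *)
  move=> k l /abe [] -> /abe [] ->; rewrite ?eqxx // => _;
    rewrite ?pillow_new_a ?pillow_new_b ?pillow_new_e.
  + by rewrite -glueAB PK.
  + exact: (pillow_glue_F2 F1 F2 pq).
  + exact: glueAB.
  + exact: (pillow_glue_F1 coX pq F12).
  + rewrite -[RHS]PK; congr glue; apply/esym; exact: (pillow_glue_F2 F1 F2 pq).
  + rewrite -[RHS]PK; congr glue; apply/esym; exact: (pillow_glue_F1 coX pq F12).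
- move=> f /pillow_step_face_cases [[g gP ->]|[k kP [] ->]]; rewrite -/transfer'.
  + rewrite glueE // !transfer_outside ?common_face_glue //.
    exact: (pillow_glue_outside coX pq pillow_step_orientation F12).
  + have [kC ek] := cdP kP; rewrite newE //; last by rewrite eq_sym.
    by rewrite transfer'_cd // transfer'_e glue_inr_e.
  have [kC ek] := cdP kP; rewrite newE //.
  by rewrite transfer'_cd // transfer'_e glue_inr_e.
(* Relative to the boundary of the 4-simplex, [inr true] is oriented like [tA] and [tB], and
   [inr false] like [new e]. *)
- have frameP s : frame (c := P) (inr s) = ~~ (frame tA (+) odd b (+) odd e) (+) s.
    have -> : frame (c := P) (inr s) = frame tA (+) odd (pos b e) (+) odd q (+) s by [].
    rewrite (odd_pos be) -/q.
    by case: (frame tA) (odd b) (odd e) (odd q) s => [] [] [] [] [].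
  move=> f /pillow_step_face_cases [[g gP ->]|[k kP [] ->]]; rewrite -/transfer'.
  + rewrite transfer_outside // orE //.
    exact: (face_or_outside pillow_step_orientation).
  + have [kC ek] := cdP kP; have ke : k != e by rewrite eq_sym.
    rewrite transfer'_cd // /face_or [frame _]frameP frame_new // (odd_pos ke).
    by case: (frame tA) (odd b) (odd e) (odd k) (odd (pos e k)) => [] [] [] [] [].
  have [kC ek] := cdP kP; rewrite transfer'_e // /face_or [frame _]frameP frame_new //.
  by rewrite addbF.
Qed.

End PillowStep.

(** The rotation about cd runs through acde from acd to cde, crosses cde, and runs through bcde to
    bcd: a single crossing. *)
Lemma sector_bipyramid (X : complex) (a b e : 'I_5) (tA tB : tet X) :
  a != b -> a != e -> b != e -> glue (tA, pos b a) = (tB, pos a b) ->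
  @sector X ((tA, pos b e), pos (pos e b) (pos e a))
            ((tB, pos a e), pos (pos e a) (pos e b)).
Proof.
move=> ab ae be gAB; have ba : b != a by rewrite eq_sym.
have [ea eb] : e != a /\ e != b by rewrite ![e == _]eq_sym.
exists 1; rewrite /= (pos_pos eb ea ba) lift_pos ?pos_inj // /cross /= gAB.
rewrite (pos_pos ba be ae) /turn lift_pos ?pos_inj 1?eq_sym //.
by rewrite (pos_pos ae ab eb).
Qed.

(* The sliding along cd with third vertices a, b is allowed. *)
Definition slidable (a b c d : nat) : bool :=
  [&& uniq [:: a; b; c; d], ~~ [&& a < c, a < d, b < c & b < d]
    & ~~ [&& c < a, c < b, d < a & d < b]].

(** The negation in the last equality comes from [frame_new]: [tC] is [new d], a new tetrahedron of
    the move with apices a, b and an old one of the move with apices c, d. *)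
Lemma mp_pure_sliding (G G' : ograph) (a b c d : 'I_5) (tA tB : vert G)
    (old_vert : vert G -> vert G') (new : 'I_5 -> vert G') :
  slidable a b c d -> @two_three (dual G) (dual G') a b tA tB old_vert new ->
  exists (H : ograph) (tC tD : vert G') (old_vert' : vert G' -> vert H)
         (new' : 'I_5 -> vert H),
    [/\ pure_sliding G H,
        @two_three (dual G') (dual H) c d tC tD old_vert' new'
      & positive tC (+) odd d = ~~ (positive tA (+) odd b)].
Proof.
case/and3P => uniq4 sep1 sep2 mp.
have [e e4] : exists e, e \notin [:: a; b; c; d] by exact: exists_notin.
have abcde : uniq [:: a; b; c; d; e].
  rewrite -[_ :: _]/(rcons [:: a; b; c; d] e) rcons_uniq e4.
  by move: uniq4; rewrite -(map_inj_uniq val_inj).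
pose p := pos e a; pose q := pos e b.
pose F1 := (tA, pos b e); pose F2 := (tB, pos a e).
have coG := dual_closed_oriented G.
have := abcde; rewrite /= !inE !negb_or !andbT.
move=> /and4P [/and4P [ab ac ad ae] /and3P [bc bd be] /andP [cd ce] de].
have [ea eb ec ed] : [/\ e != a, e != b, e != c & e != d].
  by rewrite ![e == _]eq_sym.
have [H isoH] : exists H, iso (@pillow (dual G) p q F1 F2 true) (dual H).
  apply: realize.
  - exact: pillow_closed_oriented coG (pillow_step_orientation coG abcde mp).
  - by apply/card_gt0P; exists (inr true).
  apply: pillow_connected => //.
  - by rewrite pos_inj.
  - exact: pillow_step_orientation coG abcde mp.
  - by rewrite xpair_eqE; case: mp => -[/negbTE -> _].
  exact: dual_connected.
have [old_vert' [new' mpH]] := two_three_iso isoH (two_three_pillow coG abcde mp).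
exists H, (new d), (new c), old_vert', new'; split=> //; last first.
  have := frame_new abcde mp (k := d); rewrite !inE negb_or ![d == _]eq_sym ad bd.
  move/(_ isT) => /=; case: (positive (new d)) (positive tA) (odd b) (odd d)
    => [] [] [] [] //=.
have gAB : @glue (dual G) (tA, pos b a) = (tB, pos a b) by case: mp => -[].
(* A pure sliding needs the ends of the edge in increasing order, whereas c and d may come in either
   order. *)
have slide x y : x = c /\ y = d \/ x = d /\ y = c -> x < y -> pure_sliding G H.
  move=> xycd ltxy; have [ex ey] : e != x /\ e != y by case: xycd => -[-> ->].
  exists (pos e x), (pos e y), p, q, F1, F2, true; split=> //.
  - rewrite ltn_pos //; split=> //=; rewrite !inE !pos_inj // !negb_or !andbT.
    have xy : x != y by rewrite neq_ltn ltxy.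
    by rewrite xy ab ![_ == a]eq_sym ![_ == b]eq_sym; case: xycd => -[-> ->];
      rewrite ac bc ad bd.
  - rewrite !ltn_pos //; apply: contra sep1 => /andP [ax bx].
    have := (ltn_trans ax ltxy, ltn_trans bx ltxy).
    by case: xycd ax bx => -[-> ->] -> -> [-> ->].
  - rewrite !ltn_pos //; apply: contra sep2 => /andP [ya yb].
    have := (ltn_trans ltxy ya, ltn_trans ltxy yb).
    by case: xycd ya yb => -[-> ->] -> -> [-> ->].
  exact: sector_bipyramid.
case: (ltngtP c d) => [|/slide|/val_inj e_cd]; [by apply: slide; left|by apply; right|].
by rewrite e_cd eqxx in cd.
Qed.

(** * Connecting the types of MP moves *)

Definition derived (G G' : ograph) : Prop :=
  exists (n : nat) (Gs : nat -> ograph),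
    [/\ Gs 0 = G,
        Gs n = G'
      & forall i : nat, i < n ->
          elementary (Gs i) (Gs i.+1) \/ elementary (Gs i.+1) (Gs i)].

Lemma derived0 G : derived G G.
Proof. by exists 0, (fun=> G). Qed.

Lemma derived_step G H K :
  elementary G H \/ elementary H G -> derived H K -> derived G K.
Proof.
move=> GH [n [Gs [Gs0 Gsn Gs_step]]].
exists n.+1, (fun i => if i is j.+1 then Gs j else G); split=> // -[_|i]; last exact: Gs_step.
by rewrite Gs0.
Qed.

Lemma derived_sym G H : derived G H -> derived H G.
Proof.
case=> n [Gs [Gs0 Gsn Gs_step]]; exists n, (fun i => Gs (n - i)).
split=> [||i ltin]; rewrite ?subn0 ?subnn //.
rewrite -[n - i]prednK ?subn_gt0 // -subnS or_comm; apply: Gs_step.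
by rewrite ltn_subrL (leq_ltn_trans _ ltin).
Qed.

(** The type of an MP move is recorded by its apices and the orientation [s] relative to the
    boundary of the 4-simplex; by [frame_other_apex], [tB] and [a] yield the same [s]. *)
Definition derivable (a b : 'I_5) (s : bool) : Prop :=
  forall (G G' : ograph) (tA tB : vert G) (old_vert : vert G -> vert G')
         (new : 'I_5 -> vert G'),
  @two_three (dual G) (dual G') a b tA tB old_vert new ->
  positive tA (+) odd b = s -> derived G G'.

Lemma derivable_slide (a b c d : 'I_5) (s : bool) :
  slidable a b c d -> derivable c d (~~ s) -> derivable a b s.
Proof.
move=> abcd IH G G' tA tB old_vert new mp s_tA.
have [H [tC [tD [old_vert' [new' [GH mpH]]]]]] := mp_pure_sliding abcd mp.
rewrite s_tA => /(IH _ _ _ _ _ _ mpH) /derived_sym.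
by apply: derived_step; left; right.
Qed.

(** The sign of [tA] determines the others by [frame_other_apex] and [frame_new]. All are positive
    because the old tetrahedra omit odd vertices and the new ones even vertices. *)
Lemma derivable_primary (a b : 'I_5) (s : bool) :
  [&& a == 1 :> nat, b == 3 :> nat & ~~ s] -> derivable a b s.
Proof.
case/and3P => /eqP a1 /eqP b3 /negbTE ->; move=> {s} G G' tA tB old_vert new mp.
have aE : a = inord 1 by apply/val_inj; rewrite /= inordK.
have bE : b = inord 3 by apply/val_inj; rewrite /= inordK.
rewrite b3 addbT => /negbFE posA; apply: derived_step (derived0 _).
left; left; exists tA, tB, old_vert, new; rewrite -aE -bE.
have abcde : uniq [:: a; b; inord 0; inord 2; inord 4].
  by rewrite -(map_inj_uniq val_inj) /= a1 b3 !inordK.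
have even k : k \in [:: inord 0; inord 2; inord 4 : 'I_5] -> positive (new k).
  move=> kP; have kab : k \in ~: [set a; b].
    rewrite !inE aE bE; move: kP; rewrite !inE => /or3P [] /eqP ->;
    by rewrite -!val_eqE /= !inordK.
  have := frame_new abcde mp kab; rewrite b3 /= posA => /negb_inj ->.
  by move: kP; rewrite !inE => /or3P [] /eqP ->; rewrite inordK.
split=> //.
  have := frame_other_apex (dual_closed_oriented G) abcde mp.
  by rewrite /= posA a1 b3 /= => /negbFE.
by split; apply: even; rewrite !inE eqxx ?orbT.
Qed.

(* The type (1, 3, false) is that of the primary MP move. *)
Fixpoint reachable (n a b : nat) (s : bool) : bool :=
  [&& a == 1, b == 3 & ~~ s] ||
  if n is m.+1 then
    has (fun c => has (fun d => slidable a b c d && reachable m c d (~~ s)) (iota 0 5))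
        (iota 0 5)
  else false.

Lemma derivable_reachable n (a b : 'I_5) s : reachable n a b s -> derivable a b s.
Proof.
elim: n a b s => [|n IHn] a b s; case/orP => [/derivable_primary //|] //.
case/hasP => c; rewrite mem_iota => /andP [_ ltc].
case/hasP => d; rewrite mem_iota => /andP [_ ltd] /andP [abcd].
move/(IHn (Ordinal ltc) (Ordinal ltd)).
exact: (derivable_slide (c := Ordinal ltc) (d := Ordinal ltd)).

Qed.

(** Each sliding negates [s], so walks of both parities to the pair 13 are needed. The disjoint
    pairs form a Petersen graph, of girth 5, so the type [(1, 3, true)] takes at least 5 slidings; 5
    suffice for every type. *)
Lemma all_reachable : all (fun s => all (fun a => all (fun b =>
  [|| a == b, (a < 2) && (b < 2), (2 < a) && (2 < b) | reachable 5 a b s])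
  (iota 0 5)) (iota 0 5)) [:: true; false].
Proof. by lazy. Qed.

Theorem theorem2p3 (G G' : ograph) (HGG' : mp_move G G') :
  exists (n : nat) (Gs : nat -> ograph),
    [/\ Gs 0 = G,
        Gs n = G'
      & forall i : nat, i < n ->
          elementary (Gs i) (Gs i.+1) \/ elementary (Gs i.+1) (Gs i)].
Proof.
case: HGG' => a [b [c [d [e [tA [tB [old_vert [new [abcde]]]]]]]]].
move=> lt_cde low high mp.
have s_in : positive tA (+) odd b \in [:: true; false] by case: (_ (+) _).
have in5 (k : 'I_5) : nat_of_ord k \in iota 0 5 by rewrite mem_iota add0n ltn_ord.
have /allP/(_ _ (in5 a))/allP/(_ _ (in5 b)) := allP all_reachable _ s_in.
case/or4P => [/eqP/val_inj e_ab|a01|a34|/derivable_reachable]; last 1 first.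
- by apply; first exact: mp.
- by move: abcde; rewrite e_ab /= inE eqxx.
(* Here a and b are 0 and 1, so both are smaller than c. *)
- move: abcde a01 low; rewrite -(map_inj_uniq val_inj) /= !inE.
  by clear; lia.
(* Here a and b are 3 and 4, so both are larger than e. *)
- move: (ltn_ord a) (ltn_ord b) (ltn_ord e).
  move: abcde a34 high; rewrite -(map_inj_uniq val_inj) /= !inE.
  by clear; lia.
Qed.
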